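(* Let $A_1,A_2,A_3,A_4,B_1,B_2,B_3,B_4\subseteq\mathbf{Z}_{109}$ be the explicit subsets defined in the context. Then the quadruple $(A_1,A_2,A_3,A_4)$ is a $4-(109;54,45,51,57;98)$ supplementary difference set in $\mathbf{Z}_{109}$, and the quadruple $(B_1,B_2,B_3,B_4)$ is a $4-(109;54,57,60,63;125)$ supplementary difference set in $\mathbf{Z}_{109}$.
   Context: $\mathbf{Z}_n$ denotes the ring (and additive group) of integers modulo $n$, and $\mathbf{Z}_n^*$ its group of invertible elements. A quadruple $(X_1,X_2,X_3,X_4)$ of subsets of $\mathbf{Z}_v$ is a $4-(v;k_1,k_2,k_3,k_4;\lambda)$ supplementary difference set (SDS, also called a difference family) if $|X_i|=k_i$ for $i=1,2,3,4$ and for every nonzero $g\in\mathbf{Z}_v$ the total number of triples $(i,x,y)$ with $i\in\{1,2,3,4\}$, $x,y\in X_i$ and $x-y=g$ equals $\lambda$. Let $n=109$ and let $H=\{1,45,63\}$, the subgroup of order $3$ of $\mathbf{Z}_{109}^*$. The $36$ cosets $\alpha_0,\dots,\alpha_{35}$ of $H$ in $\mathbf{Z}_{109}^*$ are enumerated as follows: $\alpha_0=H$, $\alpha_2=2H$, $\alpha_4=3H$, $\alpha_6=4H$, $\alpha_8=5H$, $\alpha_{10}=6H$, $\alpha_{12}=8H$, $\alpha_{14}=9H$, $\alpha_{16}=10H$, $\alpha_{18}=11H$, $\alpha_{20}=13H$, $\alpha_{22}=15H$, $\alpha_{24}=16H$, $\alpha_{26}=18H$, $\alpha_{28}=20H$,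 $\alpha_{30}=23H$, $\alpha_{32}=25H$, $\alpha_{34}=30H$, and $\alpha_{2i+1}=-\alpha_{2i}$ for $0\le i\le 17$. For $k=1,2,3,4$ set $A_k=\bigcup_{i\in J_k}\alpha_i$ and $B_k=\bigcup_{i\in L_k}\alpha_i$, where $J_1=\{0,2,5,7,8,10,12,15,16,19,20,23,24,26,29,30,33,34\}$, $J_2=\{4,5,6,7,11,15,18,19,20,22,25,30,32,33,35\}$, $J_3=\{0,1,5,6,9,10,11,14,17,20,24,26,27,28,29,31,32\}$, $J_4=\{0,3,4,6,7,9,10,12,13,22,24,25,26,27,28,29,31,33,35\}$, $L_1=\{0,3,5,6,9,10,13,15,16,18,21,23,24,27,28,30,32,34\}$, $L_2=\{1,4,5,6,7,8,10,11,12,13,16,19,20,21,25,27,30,31,34\}$, $L_3=\{0,1,2,3,4,6,10,12,13,15,16,17,20,22,23,24,25,29,34,35\}$, $L_4=\{0,1,2,3,5,8,9,12,13,14,15,16,19,21,23,25,26,28,29,33,34\}$. *)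

(* Defs.v *)
From mathcomp Require Import all_boot all_algebra.
Set Implicit Arguments.
Unset Strict Implicit.
Unset Printing Implicit Defensive.

Import GRing.Theory.
Local Open Scope ring_scope.

(* X is a 4-(v; k_1, k_2, k_3, k_4; lambda) supplementary difference set.
   'Z_v is the ring of integers modulo v only for v > 1 ('Z_0 and 'Z_1 are
   both the integers modulo 2). *)
Definition is_SDS4 (v : nat) (X : 4.-tuple {set 'Z_v}) (k : 4.-tuple nat)
    (lambda : nat) : Prop :=
  (forall i : 'I_4, #|tnth X i| = tnth k i) /\
  (forall g : 'Z_v, g != 0 ->
     #|[set t : 'I_4 * 'Z_v * 'Z_v |
          let: (i, x, y) := t in
          [&& x \in tnth X i, y \in tnth X i & x - y == g]]| = lambda).

Definition H : {set 'Z_109} := [set 1; 45%:R; 63%:R].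

(* coset_reps`_i * H is the coset of H with index 2i. *)
Definition coset_reps : seq nat :=
  [:: 1; 2; 3; 4; 5; 6; 8; 9; 10; 11; 13; 15; 16; 18; 20; 23; 25; 30]%N.

(* The coset of H with index j, for j < 36. *)
Definition alpha (j : nat) : {set 'Z_109} :=
  let C := [set (nth 0%N coset_reps j./2)%:R * h | h in H] in
  if odd j then [set - x | x in C] else C.

Definition coset_union (J : seq nat) : {set 'Z_109} :=
  \bigcup_(i <- J) alpha i.

Definition J1 : seq nat :=
  [:: 0; 2; 5; 7; 8; 10; 12; 15; 16; 19; 20; 23; 24; 26; 29; 30; 33; 34]%N.
Definition J2 : seq nat :=
  [:: 4; 5; 6; 7; 11; 15; 18; 19; 20; 22; 25; 30; 32; 33; 35]%N.
Definition J3 : seq nat :=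
  [:: 0; 1; 5; 6; 9; 10; 11; 14; 17; 20; 24; 26; 27; 28; 29; 31; 32]%N.
Definition J4 : seq nat :=
  [:: 0; 3; 4; 6; 7; 9; 10; 12; 13; 22; 24; 25; 26; 27; 28; 29; 31; 33; 35]%N.

Definition L1 : seq nat :=
  [:: 0; 3; 5; 6; 9; 10; 13; 15; 16; 18; 21; 23; 24; 27; 28; 30; 32; 34]%N.
Definition L2 : seq nat :=
  [:: 1; 4; 5; 6; 7; 8; 10; 11; 12; 13; 16; 19; 20; 21; 25; 27; 30; 31; 34]%N.
Definition L3 : seq nat :=
  [:: 0; 1; 2; 3; 4; 6; 10; 12; 13; 15; 16; 17; 20; 22; 23; 24; 25; 29; 34;
      35]%N.
Definition L4 : seq nat :=
  [:: 0; 1; 2; 3; 5; 8; 9; 12; 13; 14; 15; 16; 19; 21; 23; 25; 26; 28; 29; 33;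
      34]%N.

Definition A1 := coset_union J1.
Definition A2 := coset_union J2.
Definition A3 := coset_union J3.
Definition A4 := coset_union J4.

Definition B1 := coset_union L1.
Definition B2 := coset_union L2.
Definition B3 := coset_union L3.
Definition B4 := coset_union L4.

(* Main.v *)
Require Import Defs.
From mathcomp Require Import all_boot all_algebra.

Set Implicit Arguments.
Unset Strict Implicit.
Unset Printing Implicit Defensive.

Import GRing.Theory.

(** The number of ways of writing g as a difference of two elements of a subset
    X of Z_v is the number of y such that y and y + g both belong to X.  If X is
    given by its indicator sequence m, a word of v bits, that number is the
    number of positions where m and its rotation by g are both true: the
    periodic autocorrelation of m at g.  Hence a quadruple is a supplementary
    difference set as soon as the weights of its four indicator sequences are
    the prescribed sizes and their autocorrelations add up to lambda at each
    shift g = 1, ..., v - 1 ([is_SDS4_autocorrelation]).  This criterion is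
    decided by a short computation on words of bits.

    It remains to find the indicator sequences of the eight sets, that is, to
    read the cosets of H as lists of residues ([mem_alpha]).  Both quadruples
    then satisfy the criterion by evaluation. *)

Definition autocorrelation (m : bitseq) (g : nat) : nat :=
  count (fun b => b.1 && b.2) (zip m (rot g m)).

Lemma nth_rot_mod (T : Type) (x0 : T) (s : seq T) (g i : nat) :
  (g <= size s) -> (i < size s) ->
  nth x0 (rot g s) i = nth x0 s ((i + g) %% size s).
Proof.
move=> le_gs lt_is; rewrite /rot nth_cat size_drop nth_drop [i + g]addnC.
case: ltnP => [|ge_i]; first by rewrite ltn_subRL => /modn_small->.
have le_s : size s <= g + i by rewrite -leq_subLR.
have lt_sub : g + i - size s < g by rewrite ltn_subLR // addnC ltn_add2r.
rewrite -[g + i in RHS](subnK le_s) modnDr modn_small ?(leq_trans lt_sub) //.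
by rewrite subnBA // [i + g]addnC nth_take.
Qed.

Lemma count_nth_ord (T : Type) (x0 : T) (a : pred T) (n : nat) (s : seq T) :
  size s = n -> count a s = #|[set i : 'I_n | a (nth x0 s i)]|.
Proof.
move=> <-; rewrite cardsE cardE size_filter -{1}[s](mkseq_nth x0) /mkseq.
by rewrite -val_enum_ord -map_comp count_map enumT.
Qed.

Section Indicator.

Variables (n : nat) (X : {set 'Z_n.+2}) (m : bitseq).
Hypotheses (size_m : size m = n.+2)
           (mE : forall x : 'Z_n.+2, (x \in X) = nth false m x).

Lemma card_indicator : #|X| = count id m.
Proof.
rewrite (@count_nth_ord _ false _ n.+2) //; congr #|pred_of_set _|.
by apply/setP=> x; rewrite inE mE.
Qed.

(** Position y of the rotation of m by g tells whether y + g belongs to X. *)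
Lemma card_differences_indicator (g : 'Z_n.+2) :
  #|[set y | ((y + g)%R \in X) && (y \in X)]| = autocorrelation m g.
Proof.
rewrite /autocorrelation (@count_nth_ord _ (false, false) _ n.+2); last first.
  by rewrite size_zip size_rot minnn.
congr #|pred_of_set _|; apply/setP=> y; rewrite !inE.
rewrite nth_zip ?size_rot // nth_rot_mod ?size_m ?(ltn_ord y) //=.
  by rewrite !mE andbC.
exact: ltnW (ltn_ord g).
Qed.

End Indicator.

(** A representation g = x - y is determined by its block i and its subtrahend
    y, so the representations can be counted block by block. *)
Lemma card_SDS4_differences (v : nat) (X : 4.-tuple {set 'Z_v}) (g : 'Z_v) :
  #|[set t : 'I_4 * 'Z_v * 'Z_v |
      let: (i, x, y) := t in
      [&& x \in tnth X i, y \in tnth X i & (x - y)%R == g]]|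
  = \sum_(i < 4) #|[set y | ((y + g)%R \in tnth X i) && (y \in tnth X i)]|.
Proof.
under eq_bigr do rewrite -sum1dep_card.
rewrite pair_big_dep /= sum1dep_card.
pose rep (p : 'I_4 * 'Z_v) := (p.1, p.2 + g, p.2)%R.
have rep_inj : injective rep by case=> [i x] [j y] [-> _ ->].
rewrite -(card_imset _ rep_inj); congr #|pred_of_set _|.
apply/setP=> -[[i x] y]; rewrite inE; apply/idP/imsetP.
  case/and3P=> Xx Xy /eqP gE; have xE : (y + g)%R = x by rewrite -gE addrC subrK.
  by exists (i, y); rewrite ?inE /rep /= xE ?Xx.
case=> -[j z]; rewrite inE /= => /andP[Xz' Xz] [-> -> ->].
by rewrite Xz' Xz addrAC subrr add0r eqxx.
Qed.

Definition autocorrelation_sum_constant (v : nat) (M : seq bitseq)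
    (lambda : nat) : bool :=
  all (fun g => sumn [seq autocorrelation m g | m <- M] == lambda)
      (iota 1 v.-1).

Lemma is_SDS4_autocorrelation (v : nat) (X : 4.-tuple {set 'Z_v})
    (M : 4.-tuple bitseq) (k : 4.-tuple nat) (lambda : nat) :
  (1 < v) ->
  (forall i, size (tnth M i) = v) ->
  (forall i (x : 'Z_v), (x \in tnth X i) = nth false (tnth M i) x) ->
  map (count id) M = k ->
  autocorrelation_sum_constant v M lambda ->
  is_SDS4 X k lambda.
Proof.
case: v X => [|[|n]] // X _ sizeM ME Mk /allP Mlambda; split=> [i | g g_neq0].
  rewrite (card_indicator (sizeM i) (ME i)) -(tnth_map (count id)).
  by congr tnth; apply: val_inj.
rewrite card_SDS4_differences.
under eq_bigr => i _ do rewrite (card_differences_indicator (sizeM i) (ME i)).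
rewrite -(big_tuple _ _ M xpredT (fun m => autocorrelation m g)).
rewrite -(eqP (Mlambda (val g) _)) ?sumnE ?big_map //.
by rewrite mem_iota lt0n g_neq0 /= (ltn_ord g).
Qed.

(** The outer reduction modulo 109 sends the negation of the residue 0, which is
    in the list when j is not less than 36, back to 0. *)
Definition alpha_residues (j : nat) : seq nat :=
  let C := [seq (nth 0 coset_reps j./2 * h %% 109) | h <- [:: 1; 45; 63]] in
  if odd j then [seq ((109 - c) %% 109) | c <- C] else C.

Lemma mem_alpha (j : nat) (x : 'Z_109) :
  (x \in alpha j) = (val x \in alpha_residues j).
Proof.
rewrite /alpha /alpha_residues.
set r := nth _ _ _.
have HE : [set (r%:R * h)%R | h in H]
    = [set z : 'Z_109 | val z \in [seq (r * h %% 109) | h <- [:: 1; 45; 63]]].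
  have val_mul h : val (r%:R * h%:R : 'Z_109)%R = (r * h %% 109).
    by rewrite -natrM; apply: val_Zp_nat.
  rewrite /H !imsetU !imset_set1 -[1%R : 'Z_109]/(1%:R)%R.
  by apply/setP=> z; rewrite !inE -!(inj_eq val_inj) !val_mul orbA.
rewrite HE; case: (odd j); last by rewrite inE.
apply/imsetP/mapP=> [[z] | [c Cc xE]].
  by rewrite inE => Cz ->; exists (val z).
have c_lt : (c < 109) by case/mapP: Cc => h _ ->; rewrite ltn_mod.
by exists (Ordinal c_lt : 'Z_109); [rewrite inE | apply: val_inj].
Qed.

Definition coset_union_indicator (J : seq nat) : bitseq :=
  let s := flatten [seq alpha_residues j | j <- J] in
  [seq i \in s | i <- iota 0 109].

Lemma mem_coset_union (J : seq nat) (x : 'Z_109) :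
  (x \in coset_union J) = nth false (coset_union_indicator J) x.
Proof.
have x_lt : (x < 109) := ltn_ord x.
rewrite (nth_map 0) ?size_iota // nth_iota // add0n /coset_union.
elim: J => [|j J IHJ]; first by rewrite big_nil inE.
by rewrite big_cons inE IHJ mem_alpha /= mem_cat.
Qed.

Lemma is_SDS4_coset_unions (J : 4.-tuple (seq nat)) (k : 4.-tuple nat)
    (lambda : nat) :
  let M := map_tuple coset_union_indicator J in
  map (count id) M = k -> autocorrelation_sum_constant 109 M lambda ->
  is_SDS4 (map_tuple coset_union J) k lambda.
Proof.
move=> M; apply: is_SDS4_autocorrelation => // i; rewrite tnth_map.
  by rewrite size_map size_iota.
by move=> x; rewrite tnth_map mem_coset_union.
Qed.

Theorem proposition2p1 :
  is_SDS4 [tuple A1; A2; A3; A4] [tuple 54; 45; 51; 57] 98 /\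
  is_SDS4 [tuple B1; B2; B3; B4] [tuple 54; 57; 60; 63] 125.
Proof.
have -> : [tuple A1; A2; A3; A4] = map_tuple coset_union [tuple J1; J2; J3; J4].
  exact: val_inj.
have -> : [tuple B1; B2; B3; B4] = map_tuple coset_union [tuple L1; L2; L3; L4].
  exact: val_inj.
by split; apply: is_SDS4_coset_unions; vm_compute.
Qed.
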